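(* Let $G$ be a directed graph. The collection of arc sets of all directed spanning trees of $G$ satisfies the weak exchange property: for any two directed spanning trees $T \neq T'$ of $G$, there exist arcs $e\in A(T)\setminus A(T')$ and $e'\in A(T')\setminus A(T)$ such that $(A(T)\setminus\{e\})\cup\{e'\}$ is the arc set of a directed spanning tree of $G$.
   Context: A directed tree is a directed graph whose underlying undirected graph is a tree and in which every vertex except one vertex $r$ (the root) has in-degree exactly $1$. A directed spanning tree of $G$ is a subgraph of $G$ that is a directed tree containing all vertices of $G$. *)

(* Defs.v *)
From mathcomp Require Import all_boot.

Set Implicit Arguments.
Unset Strict Implicit.
Unset Printing Implicit Defensive.

(* Finite directed graphs. Arcs form a type of their own, so loops, parallel
   arcs and antiparallel arcs are allowed; a simple digraph is the special case
   in which a |-> (source a, target a) is injective. *)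
Record digraph := Digraph {
  dvertex : finType;
  darc : finType;
  source : darc -> dvertex;
  target : darc -> dvertex
}.

Record subgraph (G : digraph) := Subgraph {
  verts : {set dvertex G};
  arcs : {set darc G};
  arcs_closed : [forall a in arcs, (source a \in verts) && (target a \in verts)]
}.

Section DirectedTrees.

Variable G : digraph.
Implicit Types (H : subgraph G) (a : darc G) (x y v : dvertex G).

Definition indegree H v : nat := #|[set a in arcs H | target a == v]|.

(* The underlying undirected graph of H is the multigraph with one edge for each
   arc of H: antiparallel arcs remain two distinct edges, hence form a cycle of
   length 2. *)
Definition joins a x y : bool :=
  ((source a == x) && (target a == y)) || ((source a == y) && (target a == x)).

Definition adjacent H : rel (dvertex G) :=
  [rel x y | [exists a in arcs H, joins a x y]].

Definition connected_graph H : Prop :=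
  verts H != set0 /\ {in verts H &, forall x y, connect (adjacent H) x y}.

(* The sequence (x_0, a_0), ..., (x_(k-1), a_(k-1)) encodes the closed walk
   x_0 a_0 x_1 ... x_(k-1) a_(k-1) x_0; a loop is a cycle of length k = 1. *)
Definition is_cycle H (c : seq (dvertex G * darc G)) : bool :=
  [&& c != [::], uniq (unzip1 c), uniq (unzip2 c),
      all (fun p => p.2 \in arcs H) c
    & cycle [rel p q : dvertex G * darc G | joins p.2 p.1 q.1] c].

Definition acyclic_graph H : Prop := forall c, ~~ is_cycle H c.

Definition underlying_tree H : Prop := connected_graph H /\ acyclic_graph H.

(* Nothing is required of the in-degree of r: it must be 0, because a tree on n
   vertices has n - 1 edges. *)
Definition directed_tree H : Prop :=
  underlying_tree H /\
  exists2 r, r \in verts H &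
    {in verts H, forall v, v != r -> indegree H v = 1}.

Definition directed_spanning_tree H : Prop :=
  directed_tree H /\ verts H = [set: dvertex G].

End DirectedTrees.

(* Main.v *)
Require Import Defs.
From mathcomp Require Import all_boot.

Set Implicit Arguments.
Unset Strict Implicit.
Unset Printing Implicit Defensive.

(** A spanning subgraph is a directed spanning tree rooted at [r] iff its arcs
    strictly increase some rank function on the vertices and their targets are
    exactly the vertices other than [r], each hit once.  Let [T], [T'] have
    roots [r], [r'].
    If [r = r'], let [e'] be an arc of [T'] outside [T] whose target [v] has
    minimal rank in [T'], and [e] the arc of [T] into [v].  Below that rank, [T]
    and [T'] have the same arcs, so the source of [e'] is no descendant of [v]
    in [T] and no directed cycle is created.
    If [r <> r'], let [e'] be the arc of [T'] into [r], with source [u].  The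
    path of [T] from [r] to [u] has an arc [e] outside [T'], since otherwise
    [e'] would close a directed cycle in [T'].  Exchanging [e] for [e'] breaks
    that path and moves the root to the target of [e]. *)

Section Arborescences.

Variable G : digraph.
Implicit Types (A : {set darc G}) (H : subgraph G) (a e : darc G).
Implicit Types (r u v w x y : dvertex G).

(** * Directed reachability and rank functions *)

Definition succ A : rel (dvertex G) :=
  [rel x y | [exists a in A, (source a == x) && (target a == y)]].

Definition ranked A (d : dvertex G -> nat) : Prop :=
  {in A, forall a, d (source a) < d (target a)}.

Definition arborescence A r : Prop :=
  [/\ exists d, ranked A d, {in A &, injective (@target G)}
    & @target G @: A = [set~ r]].

Lemma succP A x y :
  reflect (exists2 a, a \in A & source a = x /\ target a = y) (succ A x y).
Proof.
apply: (iffP exists_inP) => [[a aA /andP[/eqP sa /eqP ta]]|[a aA [sa ta]]].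
  by exists a.
by exists a => //; rewrite sa ta !eqxx.
Qed.

Lemma succ_arc A a : a \in A -> succ A (source a) (target a).
Proof. by move=> aA; apply/succP; exists a. Qed.

Lemma connect_last A x y :
  connect (succ A) x y ->
  x = y \/ exists2 a, a \in A & target a = y /\ connect (succ A) x (source a).
Proof.
case/connectP=> p; elim/last_ind: p y => [|p z _] y /=; first by left.
rewrite rcons_path last_rcons => /andP[xp /succP[a aA [sa ta]]] ->; right.
by exists a => //; split=> //; apply/connectP; exists p.
Qed.

Lemma ranked_connect A d x y : ranked A d -> connect (succ A) x y -> d x <= d y.
Proof.
move=> dA /connectP[p + ->]; elim: p x => //= z p IHp x /andP[/succP[a aA [<- <-]]].
by move/IHp; apply: leq_trans; apply/ltnW/dA.
Qed.

(** The number of vertices that reach [x] is a rank: along an arc all ancestors are kept, and the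
    target, which does not reach the source, is gained. *)
Lemma acyclic_ranked A :
  {in A, forall a, ~~ connect (succ A) (target a) (source a)} ->
  exists d, ranked A d.
Proof.
move=> acA; exists (fun x => #|[set u | connect (succ A) u x]|) => a aA.
apply/proper_card/properP; split.
  apply/subsetP=> u; rewrite !inE => /connect_trans; apply.
  exact/connect1/succ_arc.
by exists (target a); rewrite !inE // acA.
Qed.

(** * Cycles of the underlying graph against ranks *)

(** Choosing an arc from each vertex to its successor turns a directed cycle into an undirected one;
    distinct sources make the arcs distinct. *)
Lemma acyclic_graph_no_cycle H (s : seq (dvertex G)) :
  acyclic_graph H -> s != [::] -> uniq s -> ~~ cycle (succ (arcs H)) s.
Proof.
move=> acH s0 Us; apply/negP=> Cs.
have [x0 xs0] : exists x, x \in s.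
  by case: s s0 {Us Cs} => // x s _; exists x; rewrite mem_head.
have /succP[a0 _ _] := next_cycle Cs xs0.
(* [a0] is only a default: by [fP] the choice succeeds on [s]. *)
pose f z := odflt a0
  [pick a in arcs H | (source a == z) && (target a == next s z)].
have fP z : z \in s ->
    [/\ f z \in arcs H, source (f z) = z & target (f z) = next s z].
  move=> zs; rewrite /f; case: pickP => [a /and3P[aH /eqP sa /eqP ta]|no] //.
  have /succP[a aH [sa ta]] := next_cycle Cs zs.
  by have := no a; rewrite aH sa ta !eqxx.
have/negP[] := acH [seq (z, f z) | z <- s]; apply/and5P; split.
- by case: (s) s0.
- by rewrite /unzip1 -map_comp map_id_in.
- rewrite /unzip2 -map_comp map_inj_in_uniq // => x y xs ys /= eq_f.
  by have [_ <- _] := fP x xs; have [_ <- _] := fP y ys; rewrite eq_f.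
- by apply/allP=> _ /mapP[z zs ->] /=; have [] := fP z zs.
- rewrite cycle_map; apply: cycle_from_next => // x xs /=.
  by have [_ sx tx] := fP x xs; rewrite /joins sx tx !eqxx.
Qed.

Lemma acyclic_graph_ranked H :
  acyclic_graph H -> exists d, ranked (arcs H) d.
Proof.
move=> acH; apply: acyclic_ranked => a aH; apply/negP=> /connectP[p].
case/shortenP=> q yq Uq _ last_q.
have/negP[] := acyclic_graph_no_cycle (s := target a :: q) acH isT Uq.
by rewrite /= rcons_path yq -last_q succ_arc.
Qed.

(** At a vertex of maximal rank on an undirected cycle both cycle arcs point inwards, hence
    coincide; the cycle is then a loop, which no rank allows. *)
Lemma ranked_acyclic_graph H d :
  ranked (arcs H) d -> {in arcs H &, injective (@target G)} -> acyclic_graph H.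
Proof.
move=> dH tI c; apply/negP=> /and5P[c0 _ U2 /allP cH Cc].
have [p0 p0c] : exists p, p \in c.
  by case: (c) c0 => // p s _; exists p; rewrite mem_head.
have [p pc max_p] := @arg_maxnP _ p0 (mem c) (fun p => d p.1) p0c.
have {}max_p q : q \in c -> d q.1 <= d p.1 by apply: max_p.
have nc : next c p \in c by rewrite mem_next.
have oc : prev c p \in c by rewrite mem_prev.
have tp : target p.2 = p.1.
  case/orP: (next_cycle Cc pc) => /andP[/eqP s2 /eqP t2] //.
  by have := dH _ (cH _ pc); rewrite s2 t2 ltnNge max_p.
have to : target (prev c p).2 = p.1.
  case/orP: (prev_cycle Cc pc) => /andP[/eqP s2 /eqP t2] //.
  by have := dH _ (cH _ oc); rewrite s2 t2 ltnNge max_p.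
(* The arcs along [c] are distinct, so equal arcs sit at equal positions. *)
have eq_op : prev c p = p.
  have eq2 : (prev c p).2 = p.2 by apply: tI; rewrite ?cH // to tp.
  have U2c : uniq (map snd c) by [].
  rewrite -(nth_index p oc) -[RHS](nth_index p pc); congr nth.
  apply/eqP; rewrite -(nth_uniq p.2 _ _ U2c) ?size_map ?index_mem //.
  by rewrite !(nth_map p) ?index_mem // !nth_index // eq2.
have := prev_cycle Cc pc; rewrite eq_op /= /joins tp => /orP[]/andP[/eqP s2 _];
  by have := dH _ (cH _ pc); rewrite s2 tp ltnn.
Qed.

(** * Structure of an arborescence and the exchange of one arc *)

Section OneArborescence.

Variables (A : {set darc G}) (r : dvertex G).
Hypothesis arbA : arborescence A r.

Lemma arborescence_in_arc v : v != r -> exists2 a, a \in A & target a = v.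
Proof.
have [_ _ tA] := arbA; move=> vr.
have : v \in @target G @: A by rewrite tA !inE.
by case/imsetP=> a; exists a.
Qed.

Lemma arborescence_no_arc_into_root a : a \in A -> target a != r.
Proof.
have [_ _ tA] := arbA; move=> aA.
by have := imset_f (@target G) aA; rewrite tA !inE.
Qed.

(** Following incoming arcs backwards lowers the rank, so the walk stops, and it can stop only at
    [r]. *)
Lemma arborescence_connect v : connect (succ A) r v.
Proof.
have [[d dA] _ _] := arbA.
have [n] := ubnP (d v); elim: n v => // n IHn v; rewrite ltnS => dv.
have [-> //|/arborescence_in_arc[a aA ta]] := eqVneq v r.
have := IHn (source a); rewrite -ta in dv *; move/(_ (leq_trans (dA _ aA) dv)).
by move/connect_trans; apply; apply/connect1/succ_arc.
Qed.

(** Without [e], exactly [r] and [target e] lack an incoming arc; [e'] enters one of them and the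
    other becomes the root. *)
Lemma arborescence_exchange e e' :
  e \in A -> target e' = target e \/ target e' = r ->
  ~~ connect (succ (A :\ e)) (target e') (source e') ->
  exists r', arborescence ((A :\ e) :|: [set e']) r'.
Proof.
have [[d dA] tI tA] := arbA; move=> eA te' nc.
have t_e : @target G @: (A :\ e) = [set~ r] :\ target e.
  apply/setP=> v; rewrite -tA in_setD1; apply/imsetP/andP.
    case=> a /setD1P[ae aA] ->; split; last exact: imset_f.
    by apply: contra_neq ae; apply: tI.
  case=> ve /imsetP[a aA va]; exists a => //.
  by rewrite in_setD1 aA andbT; apply: contra_neq ve => <-.
have te'P : target e' \notin [set~ r] :\ target e.
  by rewrite !inE; case: te' => ->; rewrite eqxx ?andbF.
exists (if target e' == r then target e else r); split.
(* All descendants of [target e'] are raised by the same amount, enough to pass [source e'], which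
   is not one of them. *)
- exists (fun x => d x + connect (succ (A :\ e)) (target e') x * (d (source e')).+1).
  move=> a /setUP[aA|/set1P->]; last first.
    by rewrite (negPf nc) connect0 mul0n mul1n addn0 addnS ltnS leq_addl.
  have /setD1P[_ /dA da] := aA; rewrite -addSn leq_add // leq_mul2r; apply/orP; right.
  case: (boolP (connect _ _ (source a))) => // /connect_trans -> //.
  exact/connect1/succ_arc.
- move=> a b /setUP[aA|/set1P->] /setUP[bA|/set1P->] // tab.
  + by move: aA bA => /setD1P[_ aA] /setD1P[_ bA]; apply: tI.
  + by case/negP: te'P; rewrite -t_e -tab imset_f.
  + by case/negP: te'P; rewrite -t_e tab imset_f.
- have er := arborescence_no_arc_into_root eA.
  rewrite imsetU imset_set1 t_e; apply/setP=> v; rewrite !inE.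
  case: te' => ->; first rewrite (negPf er); last rewrite eqxx.
    by case: (eqVneq v (target e)) => [->|]; rewrite ?er ?orbF.
  by case: (eqVneq v r) => [->|]; rewrite ?orbT ?orbF ?andbT // eq_sym er.
Qed.

End OneArborescence.

(** * Directed spanning trees are arborescences *)

Lemma directed_spanning_tree_arborescence H :
  directed_spanning_tree H -> exists r, arborescence (arcs H) r.
Proof.
case=> [[[_ acH] [r _ deg1]] HT]; have [d dH] := acyclic_graph_ranked acH.
have {}deg1 v : v != r -> exists a, [set b in arcs H | target b == v] = [set a].
  by move=> vr; apply/cards1P/eqP/deg1; rewrite ?HT ?inE.
have rP a : a \in arcs H -> target a != r.
  (* No arc enters a vertex of minimal rank, whereas every vertex other than [r] has an incoming
     arc; so this vertex is [r]. *)
  have [v _ min_v] := @arg_minnP _ r xpredT d isT.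
  have [<- aH|/deg1[b /setP/(_ b)]] := eqVneq v r.
    apply/eqP=> ta; have := dH _ aH; rewrite ta ltnNge.
    by rewrite min_v.
  rewrite !inE eqxx => /andP[bH /eqP tb].
  by have := dH _ bH; rewrite tb ltnNge min_v.
exists r; split; first by exists d.
- move=> a b aH bH tab; have [c /setP eq_c] := deg1 _ (rP a aH).
  have := eq_c b; have := eq_c a.
  by rewrite !inE aH bH -tab eqxx => /esym/eqP-> /esym/eqP->.
- apply/setP=> v; rewrite !inE; apply/imsetP/idP => [[a /rP + ->] //|].
  case/deg1=> a /setP/(_ a); rewrite !inE eqxx => /andP[aH /eqP ta].
  by exists a.
Qed.

Lemma arborescence_directed_spanning_tree A r :
  arborescence A r ->
  exists2 H : subgraph G, directed_spanning_tree H & arcs H = A.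
Proof.
move=> arbA; have [[d dA] tI tA] := arbA.
have closedA : [forall a in A, (source a \in setT) && (target a \in setT)].
  by apply/forall_inP=> a _; rewrite !inE.
exists (Subgraph closedA) => //; set H := Subgraph closedA.
split=> //; split; last first.
  exists r => [|v _ vr]; first by rewrite inE.
  have [a aA ta] := arborescence_in_arc arbA vr.
  apply/eqP/cards1P; exists a; apply/setP=> b; rewrite !inE.
  apply/andP/eqP=> [[bA /eqP tb]|->]; last by rewrite ta.
  by apply: tI; rewrite // ta.
split; last exact: (@ranked_acyclic_graph H d).
split; first by apply/set0Pn; exists r; rewrite inE.
have adj_sym : connect_sym (adjacent H).
  apply: sym_connect_sym => x y.
  by apply: eq_existsb => a; rewrite /joins orbC.
have conn_r v : connect (adjacent H) r v.
  apply: connect_sub (arborescence_connect arbA v) => x y /succP[a aA [sa ta]].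
  apply/connect1/exists_inP; exists a => //.
  by rewrite /joins sa ta !eqxx.
by move=> x y _ _; apply: connect_trans (conn_r y); rewrite adj_sym.
Qed.

(** * Unreachability and the two cases of the exchange *)

(* By strong induction on the rank of [x]: the arc of [A] into [x] is also the
   arc of [A'] into [x]. *)
Lemma not_connect_below A A' r d v x :
  arborescence A r -> arborescence A' r -> ranked A' d ->
  {in A', forall a, d (target a) < d v -> a \in A} ->
  d x < d v -> ~~ connect (succ A) v x.
Proof.
move=> arbA arbA' dA' lowA.
have [n] := ubnP (d x); elim: n x => // n IHn x; rewrite ltnS => dxn dxv.
apply/negP=> /connect_last[vx|[a aA [ta va]]]; first by rewrite vx ltnn in dxv.
have [|b bA' tb] := arborescence_in_arc arbA' (v := x).
  by rewrite -ta (arborescence_no_arc_into_root arbA).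
have bA : b \in A by rewrite lowA // tb.
have eq_ab : a = b by have [_ tI _] := arbA; apply: tI; rewrite // ta tb.
have ds : d (source b) < d x by rewrite -tb dA'.
have/negP[] := IHn (source b) (leq_trans ds dxn) (ltn_trans ds dxv).
by rewrite -eq_ab.
Qed.

(** Paths to [u] from [target e] and from [r] share their last arc, so its source is a
    counterexample of lower rank; at [target e] itself the only incoming arc is the deleted [e]. *)
Lemma not_connect_root_after_cut A r e u :
  arborescence A r -> e \in A -> connect (succ A) (target e) u ->
  ~~ connect (succ (A :\ e)) r u.
Proof.
move=> arbA eA; have [[d dA] tI _] := arbA.
have [n] := ubnP (d u); elim: n u => // n IHn u; rewrite ltnS => dun eu.
apply/negP=> /connect_last[ru|[b /setD1P[be bA] [tb rb]]].
  case/connect_last: eu => [eu|[a aA [ta _]]].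
    by have := arborescence_no_arc_into_root arbA eA; rewrite eu ru eqxx.
  by have := arborescence_no_arc_into_root arbA aA; rewrite ta ru eqxx.
case/connect_last: eu => [eu|[a aA [ta ea]]].
  by case/eqP: be; apply: tI; rewrite // tb eu.
have eq_ab : a = b by apply: tI; rewrite // ta tb.
rewrite eq_ab in ea; have sbn : d (source b) < n.
  by apply: leq_trans dun; rewrite -tb dA.
by have/negP[] := IHn _ sbn ea.
Qed.

Lemma same_root_exchange A A' r :
  arborescence A r -> arborescence A' r -> A != A' ->
  exists e e', [/\ e \in A :\: A', e' \in A' :\: A
    & exists r', arborescence ((A :\ e) :|: [set e']) r'].
Proof.
move=> arbA arbA' neq; have [[d' dA'] tI' _] := arbA'; have [_ tI _] := arbA.
(* Both sets have the same targets, each hit once, so an inclusion would be an equality. *)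
have [e0 e0P] : exists e0, e0 \in A' :\: A.
  apply/set0Pn; rewrite setD_eq0; apply: contra neq => sA'A.
  rewrite eqEsubset sA'A andbT; apply/subsetP=> a aA.
  have [b bA' tb] :=
    arborescence_in_arc arbA' (arborescence_no_arc_into_root arbA aA).
  by rewrite (tI _ _ aA (subsetP sA'A b bA')) // tb.
have [e' e'P min_e'] :=
  @arg_minnP _ e0 (mem (A' :\: A)) (fun a => d' (target a)) e0P.
have /setDP[e'A' e'A] := e'P.
have [e eA te] :=
  arborescence_in_arc arbA (arborescence_no_arc_into_root arbA' e'A').
exists e, e'; split=> //.
  rewrite inE eA andbT; apply: contra e'A => eA'.
  by rewrite -(tI' _ _ eA' e'A' te).
apply: (arborescence_exchange arbA) => //; first by left.
have: ~~ connect (succ A) (target e') (source e').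
  apply: (not_connect_below arbA arbA' dA'); last exact: dA'.
  (* Minimality of [e'] puts all arcs of [A'] with lower target into [A]. *)
  move=> a aA' da; apply: contraLR da => aA.
  by rewrite -leqNgt min_e' // !inE aA.
apply: contra; apply: connect_sub => x y /succP[a /setD1P[_ aA] [<- <-]].
exact/connect1/succ_arc.
Qed.

Lemma distinct_roots_exchange A A' r r' :
  arborescence A r -> arborescence A' r' -> r != r' ->
  exists e e', [/\ e \in A :\: A', e' \in A' :\: A
    & exists r'', arborescence ((A :\ e) :|: [set e']) r''].
Proof.
move=> arbA arbA' /(arborescence_in_arc arbA')[e' e'A' te'].
have [[d' dA'] _ _] := arbA'.
have e'A : e' \notin A.
  by apply/negP=> /(arborescence_no_arc_into_root arbA); rewrite te' eqxx.
have [e eP ce] :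
    exists2 e, e \in A :\: A' & connect (succ A) (target e) (source e').
  (* If no such [e] exists, the path of [A] from [r] to [source e'] lies in [A'], so [source e'] has
     rank at least that of [r = target e'], against [dA']. *)
  apply/exists_inP; apply: contraLR (dA' _ e'A'); rewrite te' -leqNgt.
  move/exists_inPn=> none; apply: (ranked_connect dA').
  suff conn v : connect (succ A) v (source e') -> connect (succ A') v (source e').
    exact/conn/(arborescence_connect arbA).
  case/connectP=> p + last_p; elim: p v last_p => [v -> //|z p IHp v] /=.
  move=> last_p /andP[/succP[a aA [sa ta]] zp].
  apply: connect_trans (IHp _ last_p zp).
  apply/connect1; rewrite -sa -ta; apply: succ_arc.
  apply: contraT => aA'; have aD : a \in A :\: A' by rewrite inE aA'.
  by have/negP[] := none a aD; rewrite ta; apply/connectP; exists p.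
have /setDP[eA _] := eP; exists e, e'; split=> //; first by rewrite inE e'A.
apply: (arborescence_exchange arbA) => //; first by right.
by rewrite te'; apply: not_connect_root_after_cut.
Qed.

Lemma subgraph_eq H H' : verts H = verts H' -> arcs H = arcs H' -> H = H'.
Proof.
case: H H' => V A cA [V' A' cA'] /= eqV eqA; case: _ / eqV cA'; case: _ / eqA.
by move=> cA'; congr Subgraph; apply: bool_irrelevance.
Qed.

End Arborescences.

Theorem theorem3 (G : digraph) (T T' : subgraph G) :
  directed_spanning_tree T -> directed_spanning_tree T' -> T <> T' ->
  exists e e' : darc G,
    [/\ e \in arcs T :\: arcs T',
        e' \in arcs T' :\: arcs T
      & exists2 T'' : subgraph G,
          directed_spanning_tree T'' & arcs T'' = (arcs T :\ e) :|: [set e']].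
Proof.
move=> dT dT' neq.
(* Both trees are spanning, so they can differ only in their arcs. *)
have neqA : arcs T != arcs T'.
  apply/eqP=> eqA; apply: neq; apply: subgraph_eq => //.
  by case: dT dT' => _ -> [_ ->].
have [r arbT] := directed_spanning_tree_arborescence dT.
have [r' arbT'] := directed_spanning_tree_arborescence dT'.
suff [e [e' [eP e'P [r'' arb'']]]] : exists e e',
    [/\ e \in arcs T :\: arcs T', e' \in arcs T' :\: arcs T
      & exists r'', arborescence ((arcs T :\ e) :|: [set e']) r''].
  by exists e, e'; split=> //; apply: arborescence_directed_spanning_tree arb''.
have [eq_r|] := eqVneq r r'; last exact: distinct_roots_exchange arbT arbT'.
by rewrite -eq_r in arbT'; apply: same_root_exchange arbT arbT' neqA.
Qed.
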